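(* Let $\Omega$ be a set with $|\Omega|>1$, and let $m\geqslant 2$ be an integer. Let $Q_0,\ldots,Q_m$ be $m+1$ partitions of $\Omega$ satisfying the following property: any $m$ of them are the minimal non-trivial partitions in a Cartesian lattice on $\Omega$. (a) If $m=2$, then the three partitions are the row, column, and letter partitions of a Latin square on $\Omega$, unique up to paratopism. (b) If $m>2$, then there is a group $T$, unique up to isomorphism, such that $Q_0,\ldots,Q_m$ are the minimal non-trivial partitions in a diagonal semilattice $\mathfrak{D}(T,m)$ on $\Omega$.
   Context: Sets and groups may be infinite. Partitions of a set $\Omega$ are ordered by $P\preccurlyeq Q$ iff every part of $P$ is contained in a part of $Q$; $\wedge$ and $\vee$ denote infimum and supremum in the lattice of all partitions of $\Omega$; $E$ is the partition into singletons, $U$ the partition with one part. A partition in a family is minimal (non-trivial) if it is minimal among the members of the family different from $E$. $|P|$ is the number (cardinality) of parts of $P$. A Cartesian decomposition of $\Omega$ of dimension $n$ is a set of $n$ partitions $P_1,\ldots,P_n$ of $\Omega$ such that $|P_i|\geqslant 2$ for all $i$ and $|p_1\cap\cdots\cap p_n|=1$ for all choices of parts $p_i\in P_i$. The Cartesian lattice ($n$-dimensional) defined by it is the set of partitions $P_J=\bigwedge_{i\in J}P_i$, for $J\subseteq\{1,\ldots,n\}$ (with $P_\emptyset=U$). Its minimal non-trivial elements are the $n$ partitions $\bigwedge_{j\neq i}P_j$, $i=1,\ldots,n$. Two partitions $P_1,P_2$ of $\Omega$ form a grid if for all $p_1\in P_1$, $p_2\in P_2$ there is a unique point of $\Omega$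 in $p_1\cap p_2$. Three partitions of $\Omega$ form a Latin square on $\Omega$ if any two of them form a grid; they are then called rows, columns and letters. A paratopism between Latin squares is an isomorphism of them as sets of partitions, i.e. a bijection of underlying sets carrying the set of three partitions of one to the set of three partitions of the other. Diagonal semilattice: for a group $T$ and an integer $m\geqslant 2$, let $T^m$ be the direct power, with elements written $[t_1,\ldots,t_m]$. For $1\leqslant i\leqslant m$ let $T_i$ be the $i$th coordinate subgroup (all entries other than the $i$th equal to $1$), and let $T_0=\{[t,t,\ldots,t]\mid t\in T\}$. Let $Q_i$ be the partition of $T^m$ into right cosets of $T_i$, $i=0,\ldots,m$. For $I\subseteq\{0,\ldots,m\}$ put $Q_I=\bigvee_{i\in I}Q_i$ (with $Q_\emptyset=E$). Then $\mathfrak{D}(T,m)=\{Q_I\mid I\subseteq\{0,\ldots,m\}\}$. A diagonal semilattice $\mathfrak{D}(T,m)$ on $\Omega$ is a set of partitions of $\Omega$ isomorphic to this one, i.e. obtained from it by transport along a bijection $T^m\to\Omega$. *)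

(* Defs.v *)
From HB Require Import structures.
From mathcomp Require Import all_boot all_order all_classical.
Set Implicit Arguments.
Unset Strict Implicit.
Unset Printing Implicit Defensive.
Local Open Scope classical_set_scope.

Record partition_of (Omega : Type) := PartitionOf {
  parts : set (set Omega);
  partsP : classical_sets.partition parts id [set: Omega]
}.

Section PartitionOrder.
Context {Omega : Type}.
Implicit Types P Q R : partition_of Omega.

HB.instance Definition _ := gen_eqMixin (partition_of Omega).
HB.instance Definition _ := gen_choiceMixin (partition_of Omega).

Lemma parts_inj : injective (@parts Omega).
Proof.
by move=> [P hP] [Q hQ] /= PQ; subst Q; congr PartitionOf; exact: Prop_irrelevance.
Qed.

Definition refines P Q : bool :=
  `[< forall p, parts P p -> exists2 q, parts Q q & p `<=` q >].

Lemma refines_refl : reflexive refines.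
Proof. by move=> P; apply/asboolP => p Pp; exists p. Qed.

Lemma refines_trans : transitive refines.
Proof.
move=> Q P R /asboolP PQ /asboolP QR; apply/asboolP => p /PQ [q Qq pq].
by have [r Rr qr] := QR _ Qq; exists r => //; exact: subset_trans qr.
Qed.

Lemma refines_anti : antisymmetric refines.
Proof.
have key P Q : refines P Q -> refines Q P -> parts P `<=` parts Q.
  move=> /asboolP PQ /asboolP QP p Pp.
  have [q Qq pq] := PQ _ Pp; have [p' Pp' qp'] := QP _ Qq.
  have [_ triv neq0] := partsP P.
  have [x px] := neq0 _ Pp.
  have pp' : p = p' by apply: triv => //; exists x; split=> //; exact/qp'/pq.
  by suff -> : p = q by []; apply/seteqP; split; rewrite ?pp'// -pp'.
move=> P Q /andP[PQ QP]; apply: parts_inj.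
by apply/seteqP; split; exact: key.
Qed.

End PartitionOrder.

Fact partition_display : Order.disp_t. Proof. exact: Order.Disp tt tt. Qed.

(* [(P <= Q)%O] means that every part of [P] is contained in a part of [Q];
   [infimums] and [supremums] below refer to this order. *)
HB.instance Definition _ (Omega : Type) :=
  Order.Le_isPOrder.Build partition_display (partition_of Omega)
    (@refines_refl Omega) (@refines_anti Omega) (@refines_trans Omega).

Lemma singletons_subproof (Omega : Type) :
  classical_sets.partition (range (@set1 Omega)) id [set: Omega].
Proof.
split.
- by apply/seteqP; split=> // x _; exists [set x] => //; exists x.
- by move=> _ _ [x _ <-] [y _ <-] [z [/= -> ->]].
- by move=> _ [x _ <-]; exists x.
Qed.

Definition singletons (Omega : Type) : partition_of Omega :=
  PartitionOf (@singletons_subproof Omega).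

Definition minimal_nontrivial (Omega : Type) (F : set (partition_of Omega)) :
    set (partition_of Omega) :=
  [set P | [/\ F P, P <> singletons Omega &
    forall R, F R -> R <> singletons Omega -> (R <= P)%O -> R = P]].

Definition cartesian_decomposition (Omega : Type) (n : nat)
    (P : 'I_n -> partition_of Omega) : Prop :=
  (forall i, exists p q, [/\ parts (P i) p, parts (P i) q & p <> q]) /\
  (forall p : 'I_n -> set Omega, (forall i, parts (P i) (p i)) ->
    exists x, \bigcap_i p i = [set x]).

(* The infimum of the empty family is the partition with one part. *)
Definition cartesian_lattice (Omega : Type) (n : nat)
    (P : 'I_n -> partition_of Omega) : set (partition_of Omega) :=
  [set R | exists J : set 'I_n, infimums (P @` J) R].

Definition grid (Omega : Type) (P1 P2 : partition_of Omega) : Prop :=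
  forall p1 p2, parts P1 p1 -> parts P2 p2 -> exists! x, (p1 `&` p2) x.

Record latin_square (Omega : Type) := LatinSquare {
  rows : partition_of Omega;
  columns : partition_of Omega;
  letters : partition_of Omega;
  grid_rows_columns : grid rows columns;
  grid_rows_letters : grid rows letters;
  grid_columns_letters : grid columns letters
}.

Definition latin_partitions (Omega : Type) (L : latin_square Omega) :
    set (partition_of Omega) :=
  [set rows L; columns L; letters L].

(* For a bijection [f], the family of the images under [f] of the members of
   [F]: each [P] in [F] has exactly one image [Q]. *)
Definition transport (Omega Omega' : Type) (f : Omega -> Omega')
    (F : set (partition_of Omega)) : set (partition_of Omega') :=
  [set Q | exists2 P, F P & parts Q = (fun p => f @` p) @` parts P].

Definition paratopic (Omega Omega' : Type)
    (L : latin_square Omega) (L' : latin_square Omega') : Prop :=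
  exists2 f : Omega -> Omega', bijective f &
    transport f (latin_partitions L) = latin_partitions L'.

Definition group_isomorphic (G H : groupType) : Prop :=
  exists f : {multiplicative G -> H}, bijective f.

Section Cosets.
Local Open Scope group_scope.

Definition right_cosets (G : groupType) (H : set G) : set (set G) :=
  range (fun x => [set h * x | h in H]).

Lemma right_cosets_subproof (G : groupType) (H : set G) :
  group_closed (mem H) ->
  classical_sets.partition (right_cosets H) id [set: G].
Proof.
move=> gH; have [/set_mem H1 HB] := gH.
have HV x : H x -> H x^-1.
  by move=> Hx; rewrite -(mul1g x^-1); apply/set_mem/HB; exact: mem_set.
have HM x y : H x -> H y -> H (x * y).
  move=> Hx Hy; rewrite -(invgK y).
  by apply/set_mem/HB; apply: mem_set => //; exact: HV.
split.
- apply/seteqP; split=> // x _; exists [set h * x | h in H].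
    by exists x.
  by exists 1 => //; rewrite mul1g.
- have key x y z : ([set h * x | h in H] z) -> ([set h * y | h in H] z) ->
      [set h * x | h in H] `<=` [set h * y | h in H].
    move=> [h Hh <-] [k Hk e] _ [l Hl <-].
    exists (l * h^-1 * k); first by apply: (HM) => //; apply: HM => //; exact: HV.
    by rewrite -mulgA e -mulgA mulKg.
  move=> _ _ [x _ <-] [y _ <-] [z [xz yz]] /=.
  by apply/seteqP; split; apply: key; eassumption.
- by move=> _ [x _ <-]; exists (1 * x); exists 1.
Qed.

Definition coset_partition (G : groupType) (H : set G)
    (gH : group_closed (mem H)) : partition_of G :=
  PartitionOf (right_cosets_subproof gH).

(* Index [0] gives the diagonal subgroup [T_0]; the mathematical index [j.+1]
   gives the coordinate subgroup of the coordinate [j : 'I_m]. *)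
Definition diagonal_subgroup (T : groupType) (m : nat) (i : 'I_m.+1) :
    set {ffun 'I_m -> T} :=
  if unlift ord0 i is Some j then [set t | forall k, k != j -> t k = 1]
  else [set t | exists u, t = [ffun => u]].
Arguments diagonal_subgroup T {m} i _.

Lemma diagonal_subgroup_closed (T : groupType) (m : nat) (i : 'I_m.+1) :
  group_closed (mem (diagonal_subgroup T i)).
Proof.
rewrite /diagonal_subgroup; case: (unlift ord0 i) => [j|].
  split=> [|x y /set_mem hx /set_mem hy]; apply: mem_set => k kj.
    by rewrite ffunE.
  by rewrite !ffunE hx// hy// invg1 mulg1.
split=> [|x y /set_mem[u ->] /set_mem[v ->]]; apply: mem_set.
  by exists 1; apply/ffunP => k; rewrite !ffunE.
by exists (u * v^-1); apply/ffunP => k; rewrite !ffunE.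
Qed.

End Cosets.

Definition diagonal_partition (T : groupType) (m : nat) (i : 'I_m.+1) :
    partition_of {ffun 'I_m -> T} :=
  coset_partition (@diagonal_subgroup_closed T m i).
Arguments diagonal_partition T {m} i.

(* The supremum of the empty family is [singletons]. *)
Definition diagonal_semilattice (T : groupType) (m : nat) :
    set (partition_of {ffun 'I_m -> T}) :=
  [set R | exists I : set 'I_m.+1, supremums (diagonal_partition T @` I) R].
Arguments diagonal_semilattice T m _ : clear implicits.

Definition is_diagonal_semilattice (Omega : Type) (T : groupType) (m : nat)
    (D : set (partition_of Omega)) : Prop :=
  exists2 f : {ffun 'I_m -> T} -> Omega, bijective f &
    D = transport f (diagonal_semilattice T m).

(* Main.v *)
Require Import Defs.
From HB Require Import structures.
From mathcomp Require Import all_boot all_order all_classical.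
Set Implicit Arguments.
Unset Strict Implicit.
Unset Printing Implicit Defensive.
Local Open Scope classical_set_scope.

(* Omitting [Q i] leaves a product decomposition of [Omega]; let [c i k] be its
   coordinate in direction [k].  Equality of [c i k] is the join of the [Q l]
   with [l] different from [i] and [k], so it is symmetric in [i] and [k], and
   equality of [c i j] and of [c i k] implies equality of [c j k].  A translation
   in direction [i] is a map that fixes the parts of [Q i] and respects all the
   [c i j].  When [m > 2] the translations act regularly on each part of [Q i],
   and for [i = 0] the group [T] they form is the required one: identifying the
   values of [c 0 j] with [T] through a base point turns [Omega] into [T^m].
   Conversely, if [Omega] is [T^m] with any of its [m + 1] directions in the
   role of [i], then [T] acts regularly by translations, whence uniqueness. *)

(** * Partitions and their blocks *)

Section Blocks.
Context {Omega : Type}.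
Implicit Types (P Q R : partition_of Omega) (x y : Omega).

(** As a union of all parts through [x] (there is just one), this is total without choosing a part.
    Partitions are handled below through the equivalence [block P x = block P y]. *)
Definition block P x : set Omega := [set y | exists2 p, parts P p & p x /\ p y].

Lemma part_block P p x : parts P p -> p x -> p = block P x.
Proof.
move=> Pp px; have [_ triv _] := partsP P.
apply/seteqP; split=> [y py|y [q Pq [qx qy]]]; first by exists p.
by rewrite (triv p q)//; exists x.
Qed.

Lemma block_part P x : parts P (block P x).
Proof.
have [cov _ _] := partsP P.
have : cover (parts P) id x by rewrite cov.
by move=> [p Pp px]; rewrite -(part_block Pp px).
Qed.

Lemma block_refl P x : block P x x.
Proof.
have [cov _ _] := partsP P.
have : cover (parts P) id x by rewrite cov.
by move=> [p Pp px]; exists p.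
Qed.

Lemma block_eqP P x y : block P x = block P y <-> block P x y.
Proof.
split=> [->|xy]; first exact: block_refl.
exact: part_block (block_part P x) xy.
Qed.

Lemma partsE P : parts P = range (block P).
Proof.
apply/seteqP; split=> [p Pp|_ [x _ <-]]; last exact: block_part.
have [_ _ /(_ _ Pp)[x px]] := partsP P.
by exists x => //; rewrite -(part_block Pp px).
Qed.

Lemma le_partitionP P Q :
  (P <= Q)%O <-> forall x y, block P x = block P y -> block Q x = block Q y.
Proof.
split=> [/asboolP PQ x y /block_eqP xy|PQ].
  have [q Qq pq] := PQ _ (block_part P x).
  by rewrite -(part_block Qq (pq _ (block_refl P x))) -(part_block Qq (pq _ xy)).
apply/asboolP => p; rewrite partsE => -[x _ <-].
exists (block Q x); first exact: block_part.
by move=> y /block_eqP/PQ/block_eqP.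
Qed.

Lemma eq_partition P Q :
  (forall x y, block P x = block P y <-> block Q x = block Q y) -> P = Q.
Proof.
by move=> PQ; apply: Order.POrderTheory.le_anti; apply/andP; split;
  apply/le_partitionP => x y /PQ.
Qed.

Lemma kernel_subproof V (f : Omega -> V) :
  classical_sets.partition (range (fun x => [set y | f x = f y])) id [set: Omega].
Proof.
split.
- by apply/seteqP; split=> // x _; exists [set y | f x = f y] => //; exists x.
- move=> _ _ [x _ <-] [y _ <-] [z [/= xz yz]].
  by rewrite xz yz.
- by move=> _ [x _ <-]; exists x.
Qed.

Definition kernel V (f : Omega -> V) : partition_of Omega :=
  PartitionOf (kernel_subproof f).

Lemma block_kernel V (f : Omega -> V) x : block (kernel f) x = [set y | f x = f y].
Proof. by rewrite -(@part_block _ [set y | f x = f y])//; exists x. Qed.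

Lemma kernelP V (f : Omega -> V) x y :
  block (kernel f) x = block (kernel f) y <-> f x = f y.
Proof. by rewrite block_eqP block_kernel. Qed.

Lemma block_singletons x y :
  block (singletons Omega) x = block (singletons Omega) y <-> x = y.
Proof.
have -> : singletons Omega = kernel id.
  apply: parts_inj; congr ((fun h : Omega -> set Omega => range h) _); apply/funext => z.
  by apply/seteqP; split=> u /= ->.
exact: kernelP.
Qed.

Lemma singletons_le P : (singletons Omega <= P)%O.
Proof. by apply/le_partitionP => x y /block_singletons ->. Qed.

Lemma nontrivialP P :
  P <> singletons Omega <-> exists x y, block P x = block P y /\ x <> y.
Proof.
split=> [Pne|[x [y [xy ne]]] PE]; last by apply/ne/block_singletons; rewrite -PE.
apply: contra_notP Pne => H; apply: eq_partition => x y; rewrite block_singletons.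
by split=> [xy|-> //]; apply: contra_notP H => ne; exists x, y.
Qed.

Lemma infimums_imageP I (P : I -> partition_of Omega) (J : set I) R :
  infimums (P @` J) R <-> forall x y, block R x = block R y <->
    forall k, J k -> block (P k) x = block (P k) y.
Proof.
split=> [[lb glb] x y|H].
- split=> [xy k Jk|xy].
    have /le_partitionP RP : (R <= P k)%O by apply: lb; exists k.
    exact: RP.
  (* The kernel of this tuple is the infimum itself, made into a partition; the constant [set0]
     keeps indices outside [J] from separating points. *)
  pose f z k : set Omega := if pselect (J k) then block (P k) z else set0.
  have /le_partitionP: (kernel f <= R)%O.
    apply: glb => _ [k Jk <-]; apply/le_partitionP => u v /kernelP fuv.
    by have := congr1 (@^~ k) fuv; rewrite /f; case: pselect.
  apply; apply/kernelP/funext => k; rewrite /f; case: pselect => // Jk.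
  exact: xy.
- split=> [_ [k Jk <-]|S lb]; apply/le_partitionP => x y.
    by move=> /H; apply.
  move=> xy; apply/H => k Jk.
  have /le_partitionP SP : (S <= P k)%O by apply: lb; exists k.
  exact: SP.
Qed.

End Blocks.

(** By antisymmetry an order embedding is injective, so competitors for minimality in [F] and in its
    image correspond. *)
Lemma minimal_nontrivial_image (Omega Omega' : Type)
    (h : partition_of Omega -> partition_of Omega') (F : set (partition_of Omega)) :
    (forall P Q, (h P <= h Q)%O = (P <= Q)%O) ->
    h (singletons Omega) = singletons Omega' ->
  minimal_nontrivial (h @` F) = h @` minimal_nontrivial F.
Proof.
move=> h_le h1.
have h_inj : injective h.
  by move=> P Q e; apply: Order.POrderTheory.le_anti; rewrite -!h_le e Order.POrderTheory.lexx.
apply/seteqP; split=> [_ [[P FP <-] ne min]|_ [P [FP ne min] <-]].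
- exists P => //; split=> //; first by move=> e; rewrite e in ne.
  move=> R FR Rne RP; apply: (h_inj); apply: min => //; last by rewrite h_le.
  by rewrite -h1 => /h_inj.
- split => //.
    by rewrite -h1 => /h_inj.
  move=> _ [R FR <-] ne' ; rewrite h_le => RP.
  by congr h; apply: min => // e; rewrite e in ne'.
Qed.

(** * Transport of partitions along a bijection *)

Section Transport.
Context {Omega Omega' : Type} (f : Omega -> Omega') (g : Omega' -> Omega).
Hypotheses (fK : cancel f g) (gK : cancel g f).

Definition partition_image (P : partition_of Omega) : partition_of Omega' :=
  kernel (block P \o g).

Lemma transportE F : transport f F = partition_image @` F.
Proof.
have imE P : parts (partition_image P) = (fun p => f @` p) @` parts P.
  have bE x : block (partition_image P) (f x) = f @` block P x.
    rewrite block_kernel; apply/seteqP; split=> [y /=|_ [y xy <-]] /=.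
      by rewrite fK => /block_eqP xy; exists (g y).
    by rewrite !fK; exact/block_eqP.
  rewrite !partsE; apply/seteqP; split=> [_ [y _ <-]|_ [_ [x _ <-] <-]].
    by exists (block P (g y)); [exists (g y)|rewrite -bE gK].
  by exists (f x) => //; rewrite bE.
apply/seteqP; split=> [Q [P FP e]|_ [P FP <-]]; exists P => //.
by apply: parts_inj; rewrite imE.
Qed.

Lemma minimal_nontrivial_transport F :
  minimal_nontrivial (transport f F) = partition_image @` minimal_nontrivial F.
Proof.
rewrite transportE minimal_nontrivial_image// => [P Q|].
  apply/idP/idP => /le_partitionP PQ; apply/le_partitionP => x y.
    by have := PQ (f x) (f y); rewrite !kernelP /= !fK.
  by rewrite !kernelP; exact: PQ.
apply: eq_partition => x y; rewrite kernelP /= !block_singletons.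
by split=> [/(can_inj gK)|->].
Qed.

End Transport.

(** * Cartesian decompositions and the minimal members of their lattices *)

Section CartesianDecomposition.
Context {Omega : Type} {n : nat} {P : 'I_n -> partition_of Omega}.
Hypothesis decP : cartesian_decomposition P.

Lemma cartesian_point (z : 'I_n -> Omega) :
  exists x, forall k, block (P k) x = block (P k) (z k).
Proof.
have [|x xE] := decP.2 (fun k => block (P k) (z k)).
  by move=> k; exact: block_part.
exists x => k; apply/esym/block_eqP.
have : [set x] x by [].
by rewrite -xE; apply.
Qed.

Lemma cartesian_eq x y : (forall k, block (P k) x = block (P k) y) -> x = y.
Proof.
move=> xy; have [|z zE] := decP.2 (fun k => block (P k) x).
  by move=> k; exact: block_part.
have -> : x = z.
  by suff : [set z] x by []; rewrite -zE => k _; exact: block_refl.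
suff : [set z] y by [].
by rewrite -zE => k _; rewrite xy; exact: block_refl.
Qed.

Lemma cartesian_neq i :
  exists x y, block (P i) x <> block (P i) y /\
    forall k, k != i -> block (P k) x = block (P k) y.
Proof.
have [p [q [Pp Pq pq]]] := decP.1 i.
move: Pp Pq; rewrite partsE => -[x _ xp] [y' _ yq].
have [y yE] := cartesian_point (fun k => if k == i then y' else x).
exists x, y; split=> [|k /negPf ki]; last by rewrite yE ki.
by rewrite yE eqxx xp yq.
Qed.

Lemma infimum_but_one i : exists R, forall x y, block R x = block R y <->
  forall k, k != i -> block (P k) x = block (P k) y.
Proof.
pose f z k : set Omega := if k == i then set0 else block (P k) z.
exists (kernel f) => x y; rewrite kernelP; split=> [fxy k /negPf ki|H].
  by have := congr1 (@^~ k) fxy; rewrite /f ki.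
by apply/funext => k; rewrite /f; case: ifPn => // /H.
Qed.

(** A nontrivial infimum over [J] omits some [i], hence lies above the infimum over all [k != i].
    Conversely, a nontrivial member below the latter must use every [k != i], since two points
    differing only in coordinate [k] are separated by it, and cannot use [i] as well, since all the
    [P k] together separate points. *)
Lemma minimal_cartesian_lattice :
  minimal_nontrivial (cartesian_lattice P) =
  [set R | exists i, forall x y, block R x = block R y <->
    forall k, k != i -> block (P k) x = block (P k) y].
Proof.
have nontriv i R : (forall x y, block R x = block R y <->
    forall k, k != i -> block (P k) x = block (P k) y) -> R <> singletons Omega.
  move=> RE; have [x [y [xy /RE Rxy]]] := cartesian_neq i.
  by apply/nontrivialP; exists x, y; split=> // e; rewrite e in xy.
apply/seteqP; split=> [R [[J /infimums_imageP RJ] Rne min]|R [i RE]].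
- have /existsNP[i Ji] : ~ forall i, J i.
    move=> J1; have [x [y [xy ne]]] := (nontrivialP R).1 Rne.
    by apply/ne/cartesian_eq => k; apply: (RJ x y).1.
  have [S SE] := infimum_but_one i.
  exists i => x y; rewrite -SE; suff -> : S = R by [].
  apply: min; last apply/le_partitionP => u v /SE uv.
  + by exists [set k | k != i]; apply/infimums_imageP.
  + exact: nontriv SE.
  + by apply/RJ => k Jk; apply: uv; apply: contra_notN Ji => /eqP <-.
- split.
  + by exists [set k | k != i]; apply/infimums_imageP.
  + exact: nontriv RE.
  move=> S [J /infimums_imageP SJ] Sne /le_partitionP SR.
  have JE k : k != i -> J k.
    move=> ki; apply: contrapT => Jk.
    have [x [y [xy ne]]] := cartesian_neq k.
    apply: xy; apply: (RE x y).1 => //; apply: SR; apply/SJ => l Jl.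
    by apply: ne; apply: contra_notN Jk => /eqP <-.
  apply: eq_partition => x y; split=> [|/RE xy]; first exact: SR.
  apply/SJ => k Jk; have [ki|] := eqVneq k i; last exact: xy.
  have [u [v [uv ne]]] := (nontrivialP S).1 Sne; exfalso.
  apply/ne/cartesian_eq => l; have [li|] := eqVneq l i; last first.
    by apply: (RE u v).1; exact: SR.
  by apply: (SJ u v).1 => //; rewrite li -ki.
Qed.

End CartesianDecomposition.

(** * Coordinates and translations *)

(* [c k] for [k != i] are the coordinates of a product decomposition of [Omega]
   whose lines in direction [j] are the fibres of [q j]; [q i] and [c i] are
   not constrained. *)
Definition coordinates (Omega V W : Type) (I : eqType) (q : I -> Omega -> V)
    (i : I) (c : I -> Omega -> W) : Prop :=
  [/\ forall z : I -> Omega, exists x, forall k, k != i -> c k x = c k (z k),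
      forall x y, (forall k, k != i -> c k x = c k y) -> x = y &
      forall j x y, j != i ->
        q j x = q j y <-> forall k, k != i -> k != j -> c k x = c k y].

(* With [e] ranging over all maps: agreement in the coordinates [K] is the join
   of the partitions into lines in the directions outside [K]. *)
Lemma coordinates_join (Omega V W X : Type) (I : finType) (q : I -> Omega -> V)
    (i : I) (c : I -> Omega -> W) (K : pred I) (e : Omega -> X) :
    coordinates q i c ->
    (forall l x y, l != i -> ~~ K l -> q l x = q l y -> e x = e y) ->
  forall x y, (forall k, k != i -> K k -> c k x = c k y) -> e x = e y.
Proof.
move=> [pt sep lines] eq_e x y xy.
(* Induction on a list [s] of the coordinates outside [K] in which [x] and [y] may still differ;
   each step corrects one of them by moving along a line. *)
suff H (s : seq I) : {subset s <= predC K} -> forall x,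
    (forall k, k != i -> k \notin s -> c k x = c k y) -> e x = e y.
  apply: (H (enum (predC K))) => [k|k ki]; rewrite mem_enum// => Kk.
  by apply: xy => //; rewrite inE/= negbK in Kk.
elim: s {x xy} => [|l s IHs] sK x xy.
  by congr e; apply: sep => k ki; exact: xy.
have {}IHs := IHs (fun k ks => sK k (mem_behead (s := l :: s) ks)).
(* [c i i] is unconstrained, so the index [i] is simply dropped from the list. *)
have [li|li] := eqVneq l i.
  apply: IHs => k ki ks; apply: xy => //.
  by rewrite inE negb_or li ki.
have [z zE] := pt (fun k => if k == l then y else x).
rewrite (eq_e l x z) ?li//; last 2 first.
- exact: sK (mem_head _ _).
- by apply/lines => // k ki /negPf kl; rewrite zE// kl.
apply: IHs => k ki ks; rewrite zE//; case: (eqVneq k l) => // kl.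
by apply: xy => //; rewrite inE negb_or kl.
Qed.

Section Translations.
Context {Omega V W : Type} {I : finType} (q : I -> Omega -> V).
Context {c : I -> I -> Omega -> W}.
Hypothesis coord : forall i, coordinates q i (c i).

Lemma line_coord i j k x y :
  k != i -> j != i -> k != j -> q j x = q j y -> c i k x = c i k y.
Proof. by move=> ki ji kj; have [_ _ /(_ _ _ _ ji)->] := coord i; apply. Qed.

(** Equality of [c i k] is the join of the lines in directions other than [i] and [k], and [c k i]
    is constant along each of these. *)
Lemma coord_sym i k x y : i != k -> c i k x = c i k y -> c k i x = c k i y.
Proof.
move=> ik xy; apply: (coordinates_join (K := pred1 k) (coord i)) => [l u v|l _ /eqP->//].
by move=> li lk; apply: line_coord; rewrite // eq_sym.
Qed.

(* In the model [T^m], with [x_0 = 1], the relation [c i j x = c i j y] reads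
   [x_i^-1 x_j = y_i^-1 y_j]. *)
Lemma coord_trans i j k x y : i != j -> i != k -> j != k ->
  c i j x = c i j y -> c i k x = c i k y -> c j k x = c j k y.
Proof.
move=> ij ik jk xyj xyk.
apply: (coordinates_join (K := pred2 j k) (coord i)) => [l u v li|l _ /orP[]/eqP->//].
by rewrite negb_or => /andP[lj lk]; apply: line_coord => //; rewrite eq_sym.
Qed.

Lemma coord_point i (z : I -> Omega) :
  exists x, forall k, k != i -> c i k x = c i k (z k).
Proof. by have [pt _ _] := coord i; exact: pt. Qed.

Lemma coord_eq i x y : (forall k, k != i -> c i k x = c i k y) -> x = y.
Proof. by have [_ sep _] := coord i; exact: sep. Qed.

(** In the system of [j], moving along [q i] changes only the coordinate [c j i], which [coord_sym]
    shows to be equal too. *)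
Lemma line_eq i j x y : i != j -> q i x = q i y -> c i j x = c i j y -> x = y.
Proof.
move=> ij xy xyj; apply: (@coord_eq j) => k kj.
have [->|ki] := eqVneq k i; first exact: coord_sym.
exact: line_coord xy.
Qed.

Lemma line_transversal i j x z : i != j ->
  exists y, q i x = q i y /\ c i j y = c i j z.
Proof.
move=> ij; have [y yE] := coord_point j (fun k => if k == i then z else x).
exists y; split; last first.
  by apply: coord_sym; rewrite 1?eq_sym// yE// eqxx.
by have [_ _ ->//] := coord j; move=> k kj /negPf ki; rewrite yE// ki.
Qed.

(** Since [c j k] is constant on the lines [q i], its equality at [a], [b], due to [coord_trans],
    passes to [a'], [b']; together with [c i j] it gives back [c i k]. Thus moves along [q i] that
    match in one coordinate match in every other. *)
Lemma exchange i j k a a' b b' : j != i -> k != i ->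
    q i a = q i a' -> q i b = q i b' ->
    c i j a = c i j b -> c i j a' = c i j b' ->
  c i k a = c i k b -> c i k a' = c i k b'.
Proof.
move=> ji ki aa' bb' jab jab' kab; have [->//|kj] := eqVneq k j.
have cE u v : q i u = q i v -> c j k u = c j k v.
  by apply: line_coord; rewrite // eq_sym.
have : c j k a' = c j k b'.
  rewrite -(cE _ _ aa') -(cE _ _ bb').
  by apply: (@coord_trans i); rewrite // eq_sym.
move=> kab'; apply: (@coord_trans j) => //; [by rewrite eq_sym|by rewrite eq_sym|].
by apply: coord_sym; rewrite // eq_sym.
Qed.

Definition translation i (g : Omega -> Omega) : Prop :=
  (forall z, q i z = q i (g z)) /\
  forall j z w, j != i -> c i j z = c i j w -> c i j (g z) = c i j (g w).

(** Equality of [c i j] is a join of line partitions, so a map respecting all of these respects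
    it. *)
Lemma automorphism_translation i g : (forall z, q i z = q i (g z)) ->
    (forall j x y, q j x = q j y -> q j (g x) = q j (g y)) ->
  translation i g.
Proof.
move=> gi gq; split=> // j z w ji zw.
apply: (coordinates_join (K := pred1 j) (e := c i j \o g) (coord i)).
  by move=> l u v li lj /gq; apply: line_coord; rewrite // eq_sym.
by move=> l _ /eqP->.
Qed.

Lemma translation_id i : translation i id.
Proof. by []. Qed.

Lemma translation_comp i g h :
  translation i g -> translation i h -> translation i (g \o h).
Proof.
move=> [gq gc] [hq hc]; split=> [z|j z w ji /hc-/(_ ji)/gc]; last exact.
by rewrite /= -gq.
Qed.

Lemma translation_rigid i g h x : 2 < #|I| ->
  translation i g -> translation i h -> g x = h x -> g = h.
Proof.
move=> I_gt2 [gq gc] [hq hc] ghx.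
have /card_gt1P[j [k []]] : 1 < #|[set~ i]%SET|.
  by rewrite cardsC1 ltn_predRL.
rewrite !inE => ji ki jk; apply/funext => z.
(* [w] links [x] to [z]: it shares [c i k] with [x] and [c i j] with [z]. A translation keeps each
   point on its line [q i], so one further coordinate determines the image. *)
have [w wE] := coord_point i (fun l => if l == j then z else x).
have gw : g w = h w.
  apply: (@line_eq i k); rewrite 1?eq_sym -?gq -?hq//.
  have wx : c i k w = c i k x by rewrite wE// eq_sym (negPf jk).
  by rewrite (gc k w x)// (hc k w x)// ghx.
have zw : c i j z = c i j w by rewrite wE// eqxx.
apply: (@line_eq i j); rewrite 1?eq_sym -?gq -?hq//.
by rewrite (gc j z w)// (hc j z w)// gw.
Qed.

(* Slide [z] along [c i p] to the fibre of [x], move from the fibre of [x] to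
   that of [y] along the line [q i], and slide back.  This visibly preserves
   [c i j] for [j != p]; a fourth index gives the case [j = p]. *)
Lemma translation_exists i x y : 3 < #|I| -> q i x = q i y ->
  exists2 g, translation i g & g x = y.
Proof.
move=> I_gt3 xy.
have /card_gt2P[p [j0 [k0 [[]]]]] : 2 < #|[set~ i]%SET|.
  by rewrite cardsC1 ltn_predRL.
rewrite !inE => pi ji ki [pj jk kp].
pose move z z' u v := [/\ c i p u = c i p x, c i p v = c i p y, q i u = q i v,
  forall j, j != i -> j != p -> c i j u = c i j z &
  q i z = q i z' /\ forall j, j != i -> j != p -> c i j z' = c i j v].
have /choice[g gE] z : exists z', exists u v, move z z' u v.
  have [u uE] := coord_point i (fun l => if l == p then x else z).
  have [|v [uv vy]] := @line_transversal i p u y; first by rewrite eq_sym.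
  (* The return to the line of [z] is fixed by the single coordinate [j0]; [exchange] then shows
     that every other [j != p] agrees with it. *)
  have [|z' [zz' z'v]] := @line_transversal i j0 z v; first by rewrite eq_sym.
  have uz j : j != i -> j != p -> c i j u = c i j z.
    by move=> ? /negPf jp; rewrite uE// jp.
  exists z', u, v; split=> //; first by rewrite uE// eqxx.
  split=> // j jni jp.
  apply: (@exchange i j0 j z z' u v) => //; last by rewrite uz.
  by rewrite uz// eq_sym.
have gq z : q i z = q i (g z) by have [u [v [_ _ _ _ []]]] := gE z.
have gc j z w : j != i -> j != p -> c i j z = c i j w ->
    c i j (g z) = c i j (g w).
  move=> jni jp zw; have [u [v [ux vy uv uz [_ ->//]]]] := gE z.
  have [u' [v' [ux' vy' uv' uw [_ ->//]]]] := gE w.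
  by apply: (@exchange i p j u v u' v'); rewrite ?ux ?vy// uz// uw.
exists g.
  split=> // j z w jni; have [->{j jni}|jp] := eqVneq j p; last exact: gc.
  (* [t] differs from [z] only in coordinate [j0], where it agrees with [w]. All three share
     [c i p], so [exchange] applies to [z] and [t] through [k0], then to [t] and [w] through
     [j0]. *)
  move=> zw; have [t tE] := coord_point i (fun l => if l == j0 then w else z).
  have tz : c i k0 t = c i k0 z by rewrite tE// eq_sym (negPf jk).
  have -> : c i p (g z) = c i p (g t).
    apply: (@exchange i k0 p z (g z) t (g t)) => //.
      by apply: gc.
    by rewrite tE// (negPf pj).
  have tw : c i j0 t = c i j0 w by rewrite tE// eqxx.
  apply: (@exchange i j0 p t (g t) w (g w)) => //.
    by apply: gc; rewrite // eq_sym.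
  by rewrite -zw tE// (negPf pj).
have [u [v [ux vy uv uz [gx gv]]]] := gE x.
have ue : u = x.
  by apply: (@coord_eq i) => k kni; have [->//|/uz] := eqVneq k p; apply.
have ve : v = y.
  by apply: (@line_eq i p); rewrite // 1?eq_sym// -uv ue.
apply: (@line_eq i j0); rewrite 1?eq_sym// -?gx//.
by rewrite gv ?ve// eq_sym.
Qed.

(** Take the translation sending [g o] back to [o]: both composites have a fixed point, so rigidity
    makes them the identity. *)
Lemma translation_inv i g : 3 < #|I| -> translation i g ->
  exists2 h, translation i h & cancel g h /\ cancel h g.
Proof.
move=> I_gt3 tg; have [[o]|noO] := pselect (inhabited Omega); last first.
  by exists id => //; split=> x; case: noO; exists.
have [gq _] := tg; have [h th hgo] := translation_exists I_gt3 (esym (gq o)).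
have I_gt2 : 2 < #|I| by exact: ltn_trans I_gt3.
have hg : h \o g = id.
  by apply: (@translation_rigid i _ _ o); rewrite //; exact: translation_comp.
have gh : g \o h = id.
  apply: (@translation_rigid i _ _ (g o)); rewrite //=; last by rewrite hgo.
  exact: translation_comp.
by exists h => //; split=> x; [have := congr1 (@^~ x) hg|have := congr1 (@^~ x) gh].
Qed.

End Translations.

(** * The group of translations *)

(** A permutation group as a set of bare self-maps. Inverses are only asserted to exist; the group
    structure below chooses them. *)
Record transformations (X : Type) := Transformations {
  transformation_set : set (X -> X);
  transformation_id : transformation_set id;
  transformation_comp : forall g h, transformation_set g ->
    transformation_set h -> transformation_set (g \o h);
  transformation_inv : forall g, transformation_set g ->
    exists2 h, transformation_set h & cancel g h /\ cancel h g
}.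

Section TransformationGroup.
Context {X : Type} (G : transformations X).

Definition transformation : Type := {g : X -> X | transformation_set G g}.

HB.instance Definition _ := gen_eqMixin transformation.
HB.instance Definition _ := gen_choiceMixin transformation.

Lemma transformation_inj : injective (fun g : transformation => sval g).
Proof. by move=> [g Gg] [h Gh] /= e; exact: eq_exist. Qed.

Let one : transformation := exist _ _ (transformation_id G).
Let mul (g h : transformation) : transformation :=
  exist _ _ (transformation_comp (svalP g) (svalP h)).
Let inv (g : transformation) : transformation :=
  let h := cid2 (transformation_inv (svalP g)) in exist _ _ (s2valP h).

Let mulA : associative mul.
Proof. by move=> f g h; exact: transformation_inj. Qed.
Let mul1 : left_id one mul.
Proof. by move=> g; exact: transformation_inj. Qed.
Let mulr1 : right_id one mul.
Proof. by move=> g; exact: transformation_inj. Qed.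
Let mulV : left_inverse one inv mul.
Proof.
move=> g; apply: transformation_inj; rewrite /= /inv.
by case: cid2 => h /= _ [gK hK]; apply/funext => x /=; rewrite gK.
Qed.
Let mulrV : right_inverse one inv mul.
Proof.
move=> g; apply: transformation_inj; rewrite /= /inv.
by case: cid2 => h /= _ [gK hK]; apply/funext => x /=; rewrite hK.
Qed.

HB.instance Definition _ :=
  isGroup.Build transformation mulA mul1 mulr1 mulV mulrV.

End TransformationGroup.

(** * Groups acting regularly by translations, and coordinates in such a group *)

Section RegularTranslations.
Context {Omega V W : Type} {I : finType} (q : I -> Omega -> V).
Context {c : I -> I -> Omega -> W}.
Hypothesis coord : forall i, coordinates q i (c i).
Local Open Scope group_scope.

(** The group is abstract, so that the translation group and the group of a given diagonal
    semilattice can be compared. *)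
Record regular_translations (T : groupType) (i : I) (act : T -> Omega -> Omega) :
    Prop := RegularTranslations {
  act_translation : forall t, translation q (c := c) i (act t);
  actM : forall s t x, act (s * t) x = act s (act t x);
  act_transitive : forall x y, q i x = q i y -> exists t, act t x = y;
  act_free : forall t x, act t x = x -> t = 1
}.

(** Transitivity from [x] to [x] gives an element fixing [x], and freeness identifies it with
    [1]. *)
Lemma act1 (T : groupType) i (act : T -> Omega -> Omega) x :
  regular_translations i act -> act 1 x = x.
Proof.
by move=> reg; have [t tx] := act_transitive reg (erefl (q i x));
  rewrite -{1}(act_free reg tx).
Qed.

Lemma act_inj (T : groupType) i (act : T -> Omega -> Omega) x s t :
  regular_translations i act -> act s x = act t x -> s = t.
Proof.
move=> reg e; apply/esym/(mulgI s^-1); rewrite mulVg.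
by apply: (act_free reg (x := x)); rewrite (actM reg) -e -(actM reg) mulVg (act1 _ reg).
Qed.

Lemma regular_translations_exist i : 3 < #|I| ->
  exists (T : groupType) (act : T -> Omega -> Omega), regular_translations i act.
Proof.
move=> I_gt3; have I_gt2 : 2 < #|I| by exact: ltn_trans I_gt3.
pose G := Transformations (@translation_id _ _ _ _ q c i)
  (@translation_comp _ _ _ _ q c i) (fun g => translation_inv coord I_gt3 (g := g)).
exists (transformation G : groupType), (fun g => sval g).
split=> [g|//|x y xy|g x gx].
- exact: svalP.
- have [g tg gx] := translation_exists coord I_gt3 xy.
  by exists (exist _ g tg).
- apply: transformation_inj.
  apply: (@translation_rigid _ _ _ _ q c coord i _ _ x) => //.
  exact: svalP.
Qed.

(** Match elements with the same effect on the base point [o]; by rigidity they then act identically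
    everywhere, which makes the matching multiplicative. *)
Lemma regular_translations_isomorphic (T T' : groupType) i
    (act : T -> Omega -> Omega) (act' : T' -> Omega -> Omega) :
    inhabited Omega -> 2 < #|I| ->
    regular_translations i act -> regular_translations i act' ->
  group_isomorphic T T'.
Proof.
move=> [o] I_gt2 reg reg'.
have /choice[f fE] t : exists t', act' t' o = act t o.
  by apply: (act_transitive reg'); have [-> _] := act_translation reg t.
have /choice[f' f'E] t' : exists t, act t o = act' t' o.
  by apply: (act_transitive reg); have [-> _] := act_translation reg' t'.
have actE t : act' (f t) = act t.
  by apply: (translation_rigid coord (i := i)) (fE t) => //;
    [exact: (act_translation reg')|exact: (act_translation reg)].
have fM : {morph f : s t / s * t}.
  move=> s t; apply: (@act_inj _ _ act' o _ _ reg').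
  by rewrite (actM reg') !actE (actM reg).
pose F := @Multiplicative.Pack _ _ f
  (Multiplicative.Class (isMultiplicative.Build _ _ f fM)).
exists F; exists f' => t.
  by apply: (@act_inj _ _ act o _ _ reg); rewrite f'E fE.
by apply: (@act_inj _ _ act' o _ _ reg'); rewrite /= fE f'E.
Qed.

(* The coordinate [d x j] is the translation moving the base point [o] to the
   point of its [q i]-line with the same [c i j] as [x]. *)
Lemma group_coordinates (T : groupType) i (act : T -> Omega -> Omega) (o : Omega) :
    regular_translations i act ->
  exists d : Omega -> I -> T,
    [/\ forall x y, (forall j, j != i -> d x j = d y j) -> x = y,
        forall z : I -> T, exists x, forall j, j != i -> d x j = z j,
        forall x y, q i x = q i y <->
          exists t, forall j, j != i -> d y j = t * d x j &
        forall j x y, j != i -> q j x = q j y <->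
          forall k, k != i -> k != j -> d x k = d y k].
Proof.
move=> reg.
have [actq actc] := all_and2 (act_translation reg).
have /choice[d dE] x : exists d : I -> T,
    forall j, j != i -> c i j (act (d j) o) = c i j x.
  have /choice[d dE] j : exists t, j != i -> c i j (act t o) = c i j x.
    have [->|ji] := eqVneq j i; first by exists 1.
    have [|y [oy yx]] := @line_transversal _ _ _ _ _ _ coord i j o x.
      by rewrite eq_sym.
    by have [t ty] := act_transitive reg oy; exists t; rewrite ty.
  by exists d.
have d_uniq x j t : j != i -> c i j (act t o) = c i j x -> d x j = t.
  move=> ji tx; apply: (@act_inj _ _ act o _ _ reg).
  apply: (@line_eq _ _ _ _ _ _ coord i j); rewrite ?dE ?tx// 1?eq_sym//.
  by rewrite -!actq.
have dP x y j : j != i -> d x j = d y j <-> c i j x = c i j y.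
  move=> ji; split=> [e|xy]; first by rewrite -(dE x j ji) e dE.
  by apply: d_uniq => //; rewrite dE.
(* [act t] respects [c i j], so it multiplies every coordinate by [t] on the left: the lines [q i]
   become the right cosets of the diagonal. *)
have dM t x j : j != i -> d (act t x) j = t * d x j.
  by move=> ji; apply: d_uniq => //; rewrite (actM reg); apply: actc => //; exact: dE.
exists d; split.
- by move=> x y xy; apply: (coord_eq coord (i := i)) => j ji; apply/dP => //; exact: xy.
- move=> z; have [x xE] := coord_point coord i (fun j => act (z j) o).
  by exists x => j ji; apply: d_uniq => //; rewrite xE.
- move=> x y; split=> [xy|[t tE]].
    have [t <-] := act_transitive reg xy.
    by exists t => j; exact: dM.
  suff -> : y = act t x by exact: actq.
  apply: (coord_eq coord (i := i)) => j ji; apply/dP => //.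
  by rewrite dM// tE.
- move=> j x y ji; have [_ _ ->//] := coord i.
  by split=> H k ki kj; apply/dP; rewrite ?H//; apply/dP => //; exact: H.
Qed.

End RegularTranslations.

(** * The diagonal semilattice of a group *)

Section DiagonalModel.
Context {T : groupType} {m : nat}.
Local Open Scope group_scope.
Implicit Types (x y : {ffun 'I_m -> T}) (i : 'I_m.+1).

Lemma block_diagonal i x y :
  block (diagonal_partition T i) x = block (diagonal_partition T i) y <->
  diagonal_subgroup i (y * x^-1).
Proof.
rewrite block_eqP -(@part_block _ _ [set h * x | h in diagonal_subgroup i]).
- split=> [[h Hh <-]|H]; first by rewrite mulgK.
  by exists (y * x^-1) => //; rewrite mulgVK.
- by exists x.
- have [/set_mem H1 _] := @diagonal_subgroup_closed T m i.
  by exists 1 => //; rewrite mul1g.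
Qed.

Lemma block_diagonal0 x y :
  block (diagonal_partition T ord0) x = block (diagonal_partition T ord0) y <->
  exists u, forall k, y k = u * x k.
Proof.
rewrite block_diagonal /diagonal_subgroup unlift_none; split=> -[u yu]; exists u.
  by move=> k; rewrite -(mulgVK x y) yu !ffunE.
by apply/ffunP => k; rewrite !ffunE yu mulgK.
Qed.

Lemma block_diagonal_lift (j : 'I_m) x y :
  block (diagonal_partition T (lift ord0 j)) x =
    block (diagonal_partition T (lift ord0 j)) y <->
  forall k, k != j -> x k = y k.
Proof.
rewrite block_diagonal /diagonal_subgroup liftK; split=> H k kj.
  by rewrite -(mulgVK x y) [RHS]ffunE H// mul1g.
by rewrite !ffunE H// mulgV.
Qed.

(** Otherwise a non-identity element of [T_i] made from [t] would lie in [T_j]; a second coordinate,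
    available as [1 < m], excludes this. *)
Lemma diagonal_not_le t i j : 1 < m -> t <> 1 :> T ->
  (diagonal_partition T i <= diagonal_partition T j)%O -> i = j :> 'I_m.+1.
Proof.
move=> m_gt1 t1 /le_partitionP ij.
have two (k : 'I_m) : exists l, l != k.
  have /card_gt0P[l] : 0 < #|[set~ k]%SET| by rewrite cardsC1 card_ord ltn_predRL.
  by rewrite !inE; exists l.
case: (unliftP ord0 i) ij => [a|] ->; case: (unliftP ord0 j) => [b|] -> // ij.
- have [->//|ab] := eqVneq a b; case: t1.
  have /ij/block_diagonal_lift/(_ a ab) :
      block (diagonal_partition T (lift ord0 a)) [ffun=> 1] =
      block (diagonal_partition T (lift ord0 a)) [ffun k => if k == a then t else 1].
    by apply/block_diagonal_lift => k /negPf ka; rewrite !ffunE ka.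
  by rewrite !ffunE eqxx => <-.
- have /ij/block_diagonal0[u uE] :
      block (diagonal_partition T (lift ord0 a)) [ffun=> 1] =
      block (diagonal_partition T (lift ord0 a)) [ffun k => if k == a then t else 1].
    by apply/block_diagonal_lift => k /negPf ka; rewrite !ffunE ka.
  have [b ba] := two a; case: t1.
  have := uE a; have := uE b; rewrite !ffunE eqxx (negPf ba).
  by rewrite !mulg1 => <-.
- have [k kb] := two b; case: t1.
  have /ij/block_diagonal_lift/(_ k kb) :
      block (diagonal_partition T (ord0 : 'I_m.+1)) [ffun=> 1] =
      block (diagonal_partition T (ord0 : 'I_m.+1)) [ffun=> t].
    by apply/block_diagonal0; exists t => l; rewrite !ffunE mulg1.
  by rewrite !ffunE => <-.
Qed.

Lemma diagonal_nontrivial t i : 0 < m -> t <> 1 :> T ->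
  diagonal_partition T i <> singletons {ffun 'I_m -> T}.
Proof.
move=> m_gt0 t1; apply/nontrivialP.
case: (unliftP ord0 i) => [j|] ->.
- exists [ffun=> 1], [ffun k => if k == j then t else 1]; split.
    by apply/block_diagonal_lift => k /negPf kj; rewrite !ffunE kj.
  by move=> /ffunP/(_ j); rewrite !ffunE eqxx => /esym.
- exists [ffun=> 1], [ffun=> t]; split.
    by apply/block_diagonal0; exists t => k; rewrite !ffunE mulg1.
  by move=> /ffunP/(_ (Ordinal m_gt0)); rewrite !ffunE => /esym.
Qed.

Lemma minimal_diagonal_semilattice t : 1 < m -> t <> 1 :> T ->
  minimal_nontrivial (diagonal_semilattice T m) =
  range (fun i : 'I_m.+1 => diagonal_partition T i).
Proof.
move=> m_gt1 t1; have m_gt0 : 0 < m by exact: ltn_trans m_gt1.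
have in_D i : diagonal_semilattice T m (diagonal_partition T i).
  by exists [set i]; rewrite image_set1 supremums1.
(* If no [Q_k] lies below the supremum, it is the supremum of the empty family, namely
   [singletons]. *)
have bound R : diagonal_semilattice T m R -> R <> singletons _ ->
    exists k, (diagonal_partition T k <= R)%O.
  move=> [J [ub lub]] Rne; apply: contra_notP Rne => H.
  apply: Order.POrderTheory.le_anti; rewrite singletons_le andbT.
  by apply: lub => _ [k Jk <-]; case: H; exists k; apply: ub; exists k.
apply/seteqP; split=> [R [DR Rne min]|_ [i _ <-]].
  have [k kR] := bound _ DR Rne.
  by exists k => //; apply: min => //; exact: diagonal_nontrivial t1.
split=> [//||R DR Rne Ri]; first exact: diagonal_nontrivial t1.
have [k kR] := bound _ DR Rne.
have ki : k = i by apply: (diagonal_not_le m_gt1 t1); exact: Order.POrderTheory.le_trans Ri.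
by apply: Order.POrderTheory.le_anti; rewrite Ri -ki.
Qed.

(** In a coordinate direction the factor goes on the right, to commute with left multiplication by
    the diagonal; the inverse makes this a left action. *)
Definition diagonal_action i (t : T) x : {ffun 'I_m -> T} :=
  if unlift ord0 i is Some j then [ffun k => if k == j then x k * t^-1 else x k]
  else [ffun k => t * x k].

Lemma diagonal_actionM i s t x :
  diagonal_action i (s * t) x = diagonal_action i s (diagonal_action i t x).
Proof.
apply/ffunP => k; rewrite /diagonal_action; case: unlift => [j|]; rewrite !ffunE.
  by case: ifP => // _; rewrite invgM mulgA.
by rewrite mulgA.
Qed.

Lemma diagonal_action_free i t x : 0 < m -> diagonal_action i t x = x -> t = 1.
Proof.
rewrite /diagonal_action => m_gt0; case: unlift => [j|] /ffunP.
  move=> /(_ j); rewrite ffunE eqxx => /(canRL (mulKg _)).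
  by rewrite mulVg => /(canRL invgK); rewrite invg1.
move=> /(_ (Ordinal m_gt0)); rewrite ffunE => /(canRL (mulgK _)).
by rewrite mulgV.
Qed.

Lemma block_diagonal_action i t x :
  block (diagonal_partition T i) x =
  block (diagonal_partition T i) (diagonal_action i t x).
Proof.
rewrite /diagonal_action; case: (unliftP ord0 i) => [j|] ->.
  by apply/block_diagonal_lift => k /negPf kj; rewrite ffunE kj.
by apply/block_diagonal0; exists t => k; rewrite ffunE.
Qed.

Lemma diagonal_action_transitive i x y :
    block (diagonal_partition T i) x = block (diagonal_partition T i) y ->
  exists t, diagonal_action i t x = y.
Proof.
rewrite /diagonal_action; case: (unliftP ord0 i) => [j|] ->.
  move=> /block_diagonal_lift xy; exists ((y j)^-1 * x j); apply/ffunP => k.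
  rewrite ffunE; case: eqVneq => [->|]; last exact: xy.
  by rewrite invgM invgK mulVKg.
by move=> /block_diagonal0[u uE]; exists u; apply/ffunP => k; rewrite ffunE uE.
Qed.

Lemma diagonal_action_automorphism i j t x y :
    block (diagonal_partition T j) x = block (diagonal_partition T j) y ->
  block (diagonal_partition T j) (diagonal_action i t x) =
  block (diagonal_partition T j) (diagonal_action i t y).
Proof.
rewrite /diagonal_action; case: (unliftP ord0 j) => [b|] ->.
  move=> /block_diagonal_lift xy; apply/block_diagonal_lift => k kb.
  by case: unlift => [a|]; rewrite !ffunE xy.
move=> /block_diagonal0[u uE]; apply/block_diagonal0.
case: unlift => [a|].
  by exists u => k; rewrite !ffunE uE; case: ifP => // _; rewrite mulgA.
(* From [y = u x] one gets [t y = (t u t^-1) (t x)]. *)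
by exists (t * u * t^-1) => k; rewrite !ffunE uE !mulgA mulgVK.
Qed.

End DiagonalModel.

(** * Families any [m] members of which come from a Cartesian lattice *)

Section MinimalPartitions.
Context {Omega : Type} {m : nat} (Q : 'I_m.+1 -> partition_of Omega).
Local Notation q := (fun i => block (Q i)).

(** Each [Q j] with [j != i] is the infimum of all [P k] except one, [P (s j)]. This [s] is a
    bijection from these [j] onto the indices of [P], so [P (s k)] supplies the coordinate in
    direction [k]. *)
Lemma cartesian_coordinates i n (P : 'I_n -> partition_of Omega) :
    0 < m -> injective Q -> cartesian_decomposition P ->
    Q @` [set j | j != i] = minimal_nontrivial (cartesian_lattice P) ->
  exists c : 'I_m.+1 -> Omega -> set Omega, coordinates q i c.
Proof.
move=> m_gt0 Q_inj decP; rewrite (minimal_cartesian_lattice decP) => QE.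
have QP j : j != i -> exists s, forall x y, block (Q j) x = block (Q j) y <->
    forall k, k != s -> block (P k) x = block (P k) y.
  move=> ji; have : (Q @` [set j | j != i]) (Q j) by exists j.
  by rewrite QE.
(* [s0] is only a default, the value of [s] at [i]. *)
have [s0 _] : exists s0 : 'I_n, True.
  have /card_gt0P[j] : 0 < #|[set~ i]%SET| by rewrite cardsC1 card_ord.
  by rewrite !inE => /QP[s _]; exists s.
have /choice[s sE] j : exists s, j != i -> forall x y,
    block (Q j) x = block (Q j) y <->
    forall k, k != s -> block (P k) x = block (P k) y.
  by have [ji|] := eqVneq j i; [exists s0|move=> /QP[s sE]; exists s].
have s_inj j k : j != i -> k != i -> s j = s k -> j = k.
  move=> ji ki sjk; apply/Q_inj/eq_partition => x y.
  by rewrite sE// sjk -sE.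
have /choice[j /all_and2[ji sj]] l : exists j, j != i /\ s j = l.
  have [R RE] := infimum_but_one (P := P) l.
  have : (Q @` [set j | j != i]) R by rewrite QE; exists l.
  move=> [j /= ji QjR]; exists j; split=> //; apply: contrapT => /eqP sjl.
  have [x [y [xy ne]]] := cartesian_neq decP l.
  apply/xy; apply: (sE j ji x y).1; last by rewrite eq_sym.
  by rewrite QjR; exact/RE.
exists (fun k => block (P (s k))); split.
- move=> z; have [x xE] := cartesian_point decP (fun l => z (j l)).
  by exists x => k ki; rewrite xE (s_inj (j (s k)) k).
- move=> x y xy; apply: (cartesian_eq decP) => l.
  by rewrite -(sj l); exact: xy.
- move=> k x y ki; rewrite (sE k ki x y); split=> [H l li lk|H l lk].
    by apply: H; apply: contra_neq lk; exact: s_inj.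
  by rewrite -(sj l); apply: H => //; apply: contra_neq lk => <-.
Qed.

Context {W : Type} {c : 'I_m.+1 -> 'I_m.+1 -> Omega -> W}.
Hypothesis coord : forall i, coordinates q i (c i).

(** With [i] the only third index, the parts of [Q k] are the fibres of [c j i], and a line [q j]
    meets each fibre exactly once. *)
Lemma grid_of_coordinates i j k : j != i -> i != k -> j != k ->
  (forall l, l != j -> l != k -> l = i) -> grid (Q j) (Q k).
Proof.
move=> ji ik jk only_i p1 p2; rewrite !partsE => -[x1 _ <-] [x2 _ <-].
have kE x y : block (Q k) x = block (Q k) y <-> c j i x = c j i y.
  have [_ _ ->] := coord j; last by rewrite eq_sym.
  by split=> [|xy l lj lk]; [apply; rewrite // eq_sym|rewrite (only_i l)].
have [y [x1y yx2]] := line_transversal coord x1 x2 ji.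
exists y; split=> [|z [/block_eqP x1z /block_eqP x2z]].
  by split; apply/block_eqP => //; apply/esym/kE.
apply: (line_eq coord ji); first by rewrite -x1y -x1z.
by rewrite yx2; apply/kE.
Qed.

Lemma diagonal_semilattice_of_translations (T : groupType)
    (act : T -> Omega -> Omega) (x0 y0 : Omega) :
    1 < m -> x0 <> y0 -> regular_translations (c := c) q ord0 act ->
  exists2 D, is_diagonal_semilattice T m D & range Q = minimal_nontrivial D.
Proof.
move=> m_gt1 x0y0 reg.
have [d [d_eq d_pt q0E qjE]] := group_coordinates coord x0 reg.
(* Direction [ord0] becomes the diagonal and direction [lift ord0 j] the coordinate [j]. *)
pose g x : {ffun 'I_m -> T} := [ffun j => d x (lift ord0 j)].
have g_inj x y : g x = g y -> x = y.
  move=> /ffunP xy; apply: d_eq => j; case: (unliftP ord0 j) => [k -> _|-> /eqP//].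
  by have := xy k; rewrite !ffunE.
have /choice[f fK] t : exists x, g x = t.
  have [x xE] := d_pt (fun j => if unlift ord0 j is Some k then t k else 1%g).
  by exists x; apply/ffunP => k; rewrite ffunE xE// liftK.
have gK : cancel g f by move=> x; apply: g_inj; rewrite fK.
exists (transport f (diagonal_semilattice T m)).
  by exists f => //; exists g.
have [t t1] : exists t : T, t <> 1%g.
  apply: contrapT => /forallNP T1; apply/x0y0/d_eq => j _.
  by rewrite (contrapT (T1 (d x0 j))) (contrapT (T1 (d y0 j))).
rewrite (minimal_nontrivial_transport fK gK) (minimal_diagonal_semilattice m_gt1 t1).
rewrite image_comp; apply: eq_imagel => i _ /=; apply: eq_partition => x y.
rewrite kernelP /=; case: (unliftP ord0 i) => [j|] ->.
  rewrite block_diagonal_lift qjE//; split=> H k.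
    by move=> kj; rewrite !ffunE; apply: H => //; apply: contra_neq kj => /lift_inj.
  case: (unliftP ord0 k) => [l ->|->//] _ lj.
  by have := H l; rewrite !ffunE; apply; apply: contra_neq lj => ->.
rewrite block_diagonal0 q0E; split=> -[t' tE]; exists t' => k.
  by rewrite !ffunE tE.
case: (unliftP ord0 k) => [l ->|->//] _.
by have := tE l; rewrite !ffunE.
Qed.

Lemma translations_of_diagonal_semilattice (T : groupType) (x0 y0 : Omega) D :
    1 < m -> x0 <> y0 -> is_diagonal_semilattice T m D ->
    range Q = minimal_nontrivial D ->
  exists act : T -> Omega -> Omega, regular_translations (c := c) q ord0 act.
Proof.
move=> m_gt1 x0y0 [f [g fK gK] ->].
have [t t1] : exists t : T, t <> 1%g.
  apply: contrapT => /forallNP T1; apply/x0y0/(can_inj gK)/ffunP => j.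
  by rewrite (contrapT (T1 (g x0 j))) (contrapT (T1 (g y0 j))).
rewrite (minimal_nontrivial_transport fK gK) (minimal_diagonal_semilattice m_gt1 t1).
move=> QE.
have QP j : exists k, forall x y, block (Q j) x = block (Q j) y <->
    block (diagonal_partition T k) (g x) = block (diagonal_partition T k) (g y).
  have : range Q (Q j) by exists j.
  by rewrite QE => -[_ [k _ <-] <-]; exists k => x y; exact: kernelP.
(* Only the set of minimal partitions is matched, so [Q ord0] may correspond to any of the [m + 1]
   directions of the model. *)
have [i iE] := QP ord0.
exists (fun t x => f (diagonal_action i t (g x))); split.
- move=> s; apply: (automorphism_translation coord) => [x|j x y].
    by apply/iE; rewrite fK; exact: block_diagonal_action.
  have [k kE] := QP j => /kE xy; apply/kE; rewrite !fK.
  exact: diagonal_action_automorphism.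
- by move=> s u x; rewrite fK diagonal_actionM.
- move=> x y /iE/diagonal_action_transitive[s sxy].
  by exists s; rewrite sxy gK.
- move=> s x /(congr1 g); rewrite fK.
  by apply: diagonal_action_free; exact: ltn_trans m_gt1.
Qed.

End MinimalPartitions.

(** Paratopism sees only the set of three partitions, so the identity map serves. *)
Lemma paratopic_refl (Omega : Type) (L L' : latin_square Omega) :
  latin_partitions L = latin_partitions L' -> paratopic L L'.
Proof.
move=> LL'; exists id; first by exists id.
rewrite -LL' (transportE (f := id) (g := id))//.
rewrite -[RHS]image_id; apply: eq_imagel => P _.
by apply: eq_partition => x y; exact: kernelP.
Qed.

Unset Implicit Arguments.

Theorem theorem1p1 (Omega : Type) (m : nat) (Q : 'I_m.+1 -> partition_of Omega)
    (Omega_gt1 : exists x y : Omega, x <> y)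
    (m_ge2 : 2 <= m)
    (Q_inj : injective Q)
    (Q_cartesian : forall i : 'I_m.+1,
      exists (n : nat) (P : 'I_n -> partition_of Omega),
        cartesian_decomposition P /\
        Q @` [set j | j != i] = minimal_nontrivial (cartesian_lattice P)) :
  (m = 2 ->
    exists2 L : latin_square Omega, latin_partitions L = range Q &
      forall L' : latin_square Omega,
        latin_partitions L' = range Q -> paratopic L L') /\
  (2 < m ->
    exists2 T : groupType,
      (exists2 D, is_diagonal_semilattice T m D &
        range Q = minimal_nontrivial D) &
      forall T' : groupType,
        (exists2 D, is_diagonal_semilattice T' m D &
          range Q = minimal_nontrivial D) ->
        group_isomorphic T T').
Proof.
have [x0 [y0 x0y0]] := Omega_gt1.
have /choice[c coord] i :
    exists c : 'I_m.+1 -> Omega -> set Omega, coordinates (fun i => block (Q i)) i c.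
  have [n [P [decP QE]]] := Q_cartesian i.
  by apply: (cartesian_coordinates _ Q_inj decP QE); exact: ltn_trans m_ge2.
split=> [m2|m_gt2].
- subst m.
  pose o0 : 'I_3 := @Ordinal 3 0 isT.
  pose o1 : 'I_3 := @Ordinal 3 1 isT.
  pose o2 : 'I_3 := @Ordinal 3 2 isT.
  have ordE (l : 'I_3) : [\/ l = o0, l = o1 | l = o2].
    by case: l => -[|[|[|//]]] l3; [constructor 1|constructor 2|constructor 3];
      exact: val_inj.
  have Q01 : grid (Q o0) (Q o1).
    by apply: (grid_of_coordinates coord (i := o2)) => // l; case: (ordE l) => ->.
  have Q02 : grid (Q o0) (Q o2).
    by apply: (grid_of_coordinates coord (i := o1)) => // l; case: (ordE l) => ->.
  have Q12 : grid (Q o1) (Q o2).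
    by apply: (grid_of_coordinates coord (i := o0)) => // l; case: (ordE l) => ->.
  have LE : latin_partitions (LatinSquare Q01 Q02 Q12) = range Q.
    apply/seteqP; split=> [_ [[|]|] -> /=|_ [l _ <-]]; try by [exists o0|exists o1|exists o2].
    by case: (ordE l) => ->; [left; left|left; right|right].
  exists (LatinSquare Q01 Q02 Q12) => // L' L'E.
  by apply: paratopic_refl; rewrite LE.
(* Four directions, as the construction of translations requires. *)
- have I_gt3 : 3 < #|'I_m.+1| by rewrite card_ord.
  have [T [act reg]] := regular_translations_exist coord ord0 I_gt3.
  exists T; first exact: (diagonal_semilattice_of_translations coord m_ge2 x0y0 reg).
  move=> T' [D diagD QE].
  have [act' reg'] := translations_of_diagonal_semilattice coord m_ge2 x0y0 diagD QE.
  apply: (regular_translations_isomorphic coord (inhabits x0) _ reg reg').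
  exact: ltn_trans I_gt3.
Qed.
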